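(* Let $t\ge3$ be an integer, $c>0$ a constant, $G=G_{n,c/n}$, and let $\Delta=\Delta(G)$ be its maximum degree. Then there exist constants $c_1,c_2>0$ (depending on $t$) such that with high probability \[c_1\sqrt{\Delta}\le\tau_t(G_{n,c/n})\le c_2\sqrt{\Delta}.\]
   Context: A (proper) $t$-tone $k$-coloring of a graph $G$ is a function $f:V(G)\to\binom{[k]}{t}$ such that $|f(u)\cap f(v)|<d(u,v)$ for all distinct vertices $u,v$ ($d$ = graph distance); $\tau_t(G)$ is the least $k$ for which such a coloring exists. $G_{n,p}$ is the Erdős–Rényi random graph on $[n]$; ''with high probability'' means with probability $\to1$ as $n\to\infty$. *)

(* Defs.v *)
From Stdlib Require Import Reals.
From mathcomp Require Import all_boot.
Set Implicit Arguments. Unset Strict Implicit. Unset Printing Implicit Defensive.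

(* A graph on vertex set [n] = 'I_n is given by its edge set
   E : {set {set 'I_n}}; edges are 2-element subsets. *)
Definition pairs (n : nat) : {set {set 'I_n}} := [set e : {set 'I_n} | #|e| == 2].

Definition adj (n : nat) (E : {set {set 'I_n}}) (u v : 'I_n) : bool :=
  (u != v) && ([set u; v] \in E).

Fixpoint reach (n : nat) (E : {set {set 'I_n}}) (k : nat) (u v : 'I_n) : bool :=
  if k is k'.+1 then reach E k' u v || [exists w, reach E k' u w && adj E w v]
  else u == v.

(* graph distance: Some d (d the least walk length, necessarily < n),
   or None (= infinity) if u, v lie in different components *)
Definition dist (n : nat) (E : {set {set 'I_n}}) (u v : 'I_n) : option nat :=
  let k := find (fun k => reach E k u v) (iota 0 n) in
  if k < n then Some k else None.

Definition proper_tcol (n t k : nat) (E : {set {set 'I_n}})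
    (f : {ffun 'I_n -> {set 'I_k}}) : bool :=
  [forall v, #|f v| == t] &&
  [forall u, forall v, (u != v) ==>
     match dist E u v with
     | Some d => #|f u :&: f v| < d
     | None => true
     end].

Definition tcolorable (n t k : nat) (E : {set {set 'I_n}}) : bool :=
  [exists f : {ffun 'I_n -> {set 'I_k}}, proper_tcol t E f].

(* tau_t(G): least k admitting a proper t-tone k-coloring.  A coloring
   with k = t*n always exists (disjoint color sets), so searching in
   0..t*n gives the true minimum. *)
Definition tau (n t : nat) (E : {set {set 'I_n}}) : nat :=
  find (fun k => tcolorable t k E) (iota 0 (t * n).+1).

Definition maxdeg (n : nat) (E : {set {set 'I_n}}) : nat :=
  \max_(v : 'I_n) #|[set w | adj E v w]|.

Definition Rleb (x y : R) : bool := if Rle_dec x y then true else false.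

Definition gnp_weight (n : nat) (p : R) (E : {set {set 'I_n}}) : R :=
  Rmult (pow p #|E|) (pow (Rminus 1 p) ('C(n, 2) - #|E|)).
Arguments gnp_weight : clear implicits.

Definition gnp_prob (n : nat) (p : R) (P : pred {set {set 'I_n}}) : R :=
  \big[Rplus/R0]_(E : {set {set 'I_n}} | (E \subset pairs n) && P E)
     gnp_weight n p E.
Arguments gnp_prob : clear implicits.

(* Main.v *)
Require Import Defs.
From Stdlib Require Import Reals.
From mathcomp Require Import all_boot all_order all_algebra zify ring lra Rstruct.
Set Implicit Arguments. Unset Strict Implicit. Unset Printing Implicit Defensive.
(* [Rstruct] and [Reals] shadow [Rleb] and [dist]. *)
Import Defs.
Import Order.TTheory GRing.Theory Num.Theory.

(** Lower bound: two neighbours of a vertex are at distance at most 2, hence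
    share at most one colour; so the colour pairs picked inside their colour
    sets are distinct, and [Delta <= 'C(k, 2)].

    Upper bound: write [s = h ^ (2 * t)], where [h] is maximal with
    [s ^ (2 * s) <= n]; then [n <= s ^ O(s)], so [s] has the order of
    [log n / log log n].  With high probability:
    - [Delta >= s]: the vertices [v >= b] have independent numbers of neighbours
      in [{0, ..., b - 1}], where [b] is about [n / 2c];
    - in every ball of radius [t] the degrees that are at least [h] add up to
      [O(s)]: otherwise there is a tree with few vertices and [Omega(s)] further
      edges incident to it, and a first moment bound over such trees rules this
      out.
    On such a graph colour greedily, first the vertices of degree at least
    [h ^ t = sqrt s], with words of length [t] over an alphabet of size
    [k = O(h ^ t)].  When its turn comes a vertex sees [O(h ^ (t * d))] coloured
    vertices within distance [d], and each excludes [O(k ^ (t - d))] words out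
    of [k ^ t]. *)

(** * Graph distance and the lower bound *)

Lemma subset_card_ex (T : finType) (A : {set T}) k :
  k <= #|A| -> exists2 B : {set T}, B \subset A & #|B| = k.
Proof.
move=> le_k; exists [set:: take k (enum A)].
  by apply/subsetP => x; rewrite inE => /mem_take; rewrite mem_enum.
rewrite cardsE (card_uniqP _) ?take_uniq ?enum_uniq // size_take -cardE.
by case: ltnP => // k_le; apply/eqP; rewrite eqn_leq le_k k_le.
Qed.

Lemma leq_card_bigcup (I T : finType) (P : pred I) (F : I -> {set T}) :
  #|\bigcup_(i | P i) F i| <= \sum_(i | P i) #|F i|.
Proof.
elim/big_ind2: _ => [|A a B b leA leB|//]; first by rewrite cards0.
by apply: leq_trans (leq_card_setU _ _) _; apply: leq_add.
Qed.

Definition deg (n : nat) (E : {set {set 'I_n}}) (v : 'I_n) : nat :=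
  #|[set w | adj E v w]|.

Definition ball (n : nat) (E : {set {set 'I_n}}) (d : nat) (v : 'I_n) :
  {set 'I_n} := [set u | reach E d v u].

(** Degrees below [h] are left out: they enlarge a ball by a factor of at most [h] per step, which
    the colouring can afford. *)
Definition heavy_load (n : nat) (E : {set {set 'I_n}}) (h d : nat) (v : 'I_n) :
  nat := \sum_(w in ball E d v | h <= deg E w) deg E w.

Section Distance.
Variables (n : nat) (E : {set {set 'I_n}}).

Lemma adjC u v : adj E u v = adj E v u.
Proof. by rewrite /adj eq_sym setUC. Qed.

Lemma reach_cons k u w v : adj E u w -> reach E k w v -> reach E k.+1 u v.
Proof.
move=> uw; elim: k v => [|k IH] v /=.
  by move/eqP <-; apply/orP; right; apply/existsP; exists u; rewrite eqxx.
case/orP=> [/IH|/existsP [x /andP [/IH ux xv]]]; first by move=> /= ->.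
by apply/orP; right; apply/existsP; exists x; apply/andP.
Qed.

Lemma reachC k u v : reach E k u v = reach E k v u.
Proof.
have W x y : reach E k x y -> reach E k y x; last by apply/idP/idP; apply: W.
elim: k x y => [|k IH] x y; first by rewrite /= eq_sym.
case/orP=> [/IH /= -> //|/existsP [w /andP [/IH wx wy]]].
by apply: reach_cons wx; rewrite adjC.
Qed.

Lemma reach_mono d e u v : d <= e -> reach E d u v -> reach E e u v.
Proof.
elim: e => [|e IH]; first by rewrite leqn0 => /eqP ->.
by rewrite leq_eqVlt => /predU1P [-> //|/IH H /H /= ->].
Qed.

Lemma dist_reach u v d : dist E u v = Some d -> reach E d u v.
Proof.
rewrite /dist; set k := find _ _; case: ltnP => // lt_kn [<-].
have hs : has (fun k => reach E k u v) (iota 0 n) by rewrite has_find size_iota.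
by have := nth_find 0 hs; rewrite nth_iota.
Qed.

Lemma dist_le u v d : d < n -> reach E d u v ->
  exists2 e, e <= d & dist E u v = Some e.
Proof.
move=> lt_dn r; rewrite /dist; set k := find _ _.
suff le_kd : k <= d by exists k => //; rewrite (leq_ltn_trans le_kd).
rewrite leqNgt; apply/negP => lt_dk.
by have := before_find 0 lt_dk; rewrite nth_iota ?add0n ?r.
Qed.

Lemma deg_le_maxdeg v : deg E v <= maxdeg E.
Proof. exact: (leq_bigmax v). Qed.

Lemma ball0 v : ball E 0 v = [set v].
Proof. by apply/setP => u; rewrite !inE eq_sym. Qed.

Lemma card_ballS d v :
  #|ball E d.+1 v| <= #|ball E d v| + \sum_(w in ball E d v) deg E w.
Proof.
have sub : ball E d.+1 v \subset
    ball E d v :|: \bigcup_(w in ball E d v) [set x | adj E w x].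
  apply/subsetP => u; rewrite !inE /= => /orP [-> //|/existsP [w /andP [vw wu]]].
  by apply/orP; right; apply/bigcupP; exists w; rewrite inE.
apply: leq_trans (subset_leq_card sub) (leq_trans (leq_card_setU _ _) _).
by rewrite leq_add2l; apply: leq_card_bigcup.
Qed.

Lemma ball1 v : ball E 1 v = v |: [set w | adj E v w].
Proof.
apply/setP => u; rewrite !inE /= [v == u]eq_sym; congr (_ || _).
apply/existsP/idP => [[w /andP [/eqP <-]] //|vu].
by exists v; rewrite eqxx.
Qed.

End Distance.

Lemma tau_le t k n (E : {set {set 'I_n}}) : tcolorable t k E -> tau t E <= k.
Proof.
move=> col; rewrite leqNgt; apply/negP => lt_k.
have := before_find 0 lt_k; rewrite nth_iota ?add0n ?col //.
by apply: leq_trans lt_k _; rewrite -[leqRHS](size_iota 0) find_size.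
Qed.

Lemma maxdeg_le_sqr_tau t n (E : {set {set 'I_n}}) :
  2 <= t -> maxdeg E <= tau t E ^ 2.
Proof.
move=> t2; apply/bigmax_leqP => v _; set N := [set w | adj E v w].
have le_n : #|N| <= n by rewrite -[n in _ <= n]card_ord max_card.
(* If the search found nothing, [tau] would be the default [(t * n).+1], and the bound would follow
   from the degree being at most [n]. *)
case hs : (has (fun k => tcolorable t k E) (iota 0 (t * n).+1)); last first.
  rewrite /tau hasNfind ?hs // size_iota; apply: leq_trans le_n _; nia.
have := nth_find 0 hs; rewrite -/(tau t E); move: hs.
rewrite has_find size_iota -/(tau t E) => lt_tau.
rewrite nth_iota // add0n; move: (tau t E) => k /existsP [f].
case/andP=> /forallP f_t /forallP f_sep.
pose g w : {set 'I_k} := [set:: take 2 (enum (f w))].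
have g_sub w : g w \subset f w.
  by apply/subsetP => x; rewrite inE => /mem_take; rewrite mem_enum.
have g_2 w : #|g w| = 2.
  rewrite cardsE (card_uniqP _) ?take_uniq ?enum_uniq // size_take -cardE.
  by rewrite (eqP (f_t w)); case: ltnP => // t2le; apply/eqP; rewrite eqn_leq t2le.
have g_inj : {in N &, injective g}.
  move=> x y; rewrite !inE => vx vy gxy; apply/eqP/negP => /negP xy.
  (* [dist] only searches walks of length less than [n]. *)
  have n3 : 2 < n.
    have /subset_leq_card : [set v; x; y] \subset [set: 'I_n] by apply: subsetT.
    rewrite cardsT card_ord setUC cardsU1 cards2 !inE negb_or.
    by case/andP: vx => -> _; case/andP: vy; rewrite ![y == _]eq_sym xy => ->.
  have [|e le_e2 de] := dist_le (u := x) (v := y) (E := E) n3.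
    apply: (@reach_cons _ _ _ _ v); first by rewrite adjC.
    by apply: (@reach_cons _ _ _ _ y) => //=.
  have /forallP/(_ y) := f_sep x; rewrite xy de /= => lt_e.
  have : g x \subset f x :&: f y by rewrite subsetI g_sub gxy g_sub.
  by move/subset_leq_card; rewrite g_2 leqNgt (leq_trans lt_e le_e2).
rewrite -(card_in_imset g_inj).
have : g @: N \subset [set A : {set 'I_k} | #|A| == 2].
  by apply/subsetP => _ /imsetP [w _ ->]; rewrite inE g_2.
move/subset_leq_card/leq_trans; apply; rewrite card_draws card_ord bin2.
by rewrite -divn2; apply: leq_trans (leq_div _ _) _; nia.
Qed.

(** * Greedy colouring *)

Section Words.
Variables (t k : nat).
Implicit Types (x y : {ffun 'I_t -> 'I_k}) (D : {set 'I_t}).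

Definition agree x y : {set 'I_t} := [set i | x i == y i].

Lemma agreeC x y : agree x y = agree y x.
Proof. by apply/setP => i; rewrite !inE eq_sym. Qed.

Lemma card_agree y D : #|[set x | D \subset agree y x]| = k ^ (t - #|D|).
Proof.
pose F i : pred 'I_k := if i \in D then pred1 (y i) else predT.
have -> : #|[set x | D \subset agree y x]| = #|family F|.
  rewrite cardsE; apply: eq_card => x; rewrite !inE.
  apply/subsetP/familyP => [yx i|yx i iD].
    by rewrite /F; case: ifP => // /yx; rewrite !inE eq_sym.
  by have := yx i; rewrite /F iD !inE eq_sym.
rewrite card_family foldrE big_map big_enum /=.
rewrite (bigID (mem D)) /= big1 ?mul1n => [|i iD]; last by rewrite /F iD card1.
rewrite (eq_bigr (fun=> k)) => [|i /negPf iD]; last by rewrite /F iD card_ord.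
rewrite prod_nat_const; congr (_ ^ _).
have <- : #|~: D| = #|[predC D]| by apply: eq_card => i; rewrite !inE.
by rewrite -[t in t - _]card_ord -(cardsC D) addKn.
Qed.

Lemma card_agree_ge y d : d <= t ->
  #|[set x | d <= #|agree y x| ]| <= 2 ^ t * k ^ (t - d).
Proof.
move=> le_dt.
have sub : [set x | d <= #|agree y x| ] \subset
    \bigcup_(D : {set 'I_t} | #|D| == d) [set x | D \subset agree y x].
  apply/subsetP => x; rewrite inE => le_d.
  have [D sD /eqP cD] := subset_card_ex le_d.
  by apply/bigcupP; exists D; rewrite ?inE.
apply: leq_trans (subset_leq_card sub) (leq_trans (leq_card_bigcup _ _) _).
rewrite (eq_bigr (fun=> k ^ (t - d))) => [|D /eqP <-]; last exact: card_agree.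
rewrite sum_nat_const leq_mul2r; apply/orP; right.
rewrite -[t in 2 ^ t]card_ord -cardsT -card_powerset.
by apply: subset_leq_card; apply/subsetP => D _; rewrite powersetE subsetT.
Qed.

Variables (n : nat) (E : {set {set 'I_n}}).

(** Properness on the coloured set [P]. With [reach], the strongest condition is at [d] equal to the
    distance; for [d > t] words of length [t] comply by themselves. *)
Definition separated (P : {set 'I_n}) (g : 'I_n -> {ffun 'I_t -> 'I_k}) :=
  forall u v, u \in P -> v \in P -> u != v ->
  forall d, 0 < d <= t -> reach E d u v -> #|agree (g u) (g v)| < d.

Definition crowd (P : {set 'I_n}) d v := [set u in P | u \in ball E d v :\ v].

(** For each [d] the crowd excludes at most [k ^ t / t.+1] words, and [d] takes [t] values, so some
    word survives. *)
Lemma greedy_step (P : {set 'I_n}) v (g : 'I_n -> {ffun 'I_t -> 'I_k}) :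
  0 < k ->
  (forall d, 0 < d <= t -> #|crowd P d v| * (2 ^ t * t.+1) <= k ^ d) ->
  exists x, forall u, u \in P -> u != v ->
    forall d, 0 < d <= t -> reach E d v u -> #|agree (g u) x| < d.
Proof.
move=> k0 few.
pose bad := \bigcup_(d : 'I_t) \bigcup_(u in crowd P d.+1 v)
  [set x | d.+1 <= #|agree (g u) x| ].
have [x xbad] : exists x, x \notin bad.
  apply/existsP; rewrite -negb_forall; apply/negP => /forallP all_bad.
  have : #|{: {ffun 'I_t -> 'I_k}}| <= #|bad|.
    by rewrite -cardsT; apply: subset_leq_card; apply/subsetP => x _; apply: all_bad.
  rewrite card_ffun !card_ord => le_bad.
  have : #|bad| * t.+1 <= t * k ^ t.
    apply: leq_trans (_ : (\sum_(d < t) k ^ t) <= _); last by rewrite sum_nat_const card_ord.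
    rewrite mulnC; apply: leq_trans (leq_mul (leqnn _) (leq_card_bigcup _ _)) _.
    rewrite big_distrr /=; apply: leq_sum => d _.
    apply: leq_trans (leq_mul (leqnn _) (leq_card_bigcup _ _)) _.
    apply: leq_trans (_ : t.+1 * (\sum_(u in crowd P d.+1 v) 2 ^ t * k ^ (t - d.+1)) <= _).
      by rewrite leq_mul2l; apply/orP; right; apply: leq_sum => u _; apply: card_agree_ge.
    rewrite sum_nat_const; have := few d.+1 (ltn_ord d).
    rewrite -[in X in _ -> _ <= X](subnK (ltn_ord d)) expnD.
    move/(leq_mul (leqnn (k ^ (t - d.+1)))); lia.
  have : 0 < k ^ t by rewrite expn_gt0 k0.
  nia.
exists x => u uP uv d /andP [d0 dt] vu; rewrite ltnNge; apply/negP => le_d.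
move/negP: xbad; apply; apply/bigcupP.
have lt_d : d.-1 < t by rewrite prednK.
exists (Ordinal lt_d) => //; apply/bigcupP; exists u; rewrite /= ?prednK // ?inE //.
by rewrite uP uv.
Qed.

(** Crowds grow with the coloured set, so bounding them in the final set [P :|: Q] covers every
    stage. Only crowds around the newly coloured vertices are bounded, which lets the colouring
    proceed in two rounds with separate estimates. *)
Lemma greedy (P Q : {set 'I_n}) (g : 'I_n -> {ffun 'I_t -> 'I_k}) :
  0 < k -> separated P g ->
  (forall v, v \in Q -> forall d, 0 < d <= t ->
     #|crowd (P :|: Q) d v| * (2 ^ t * t.+1) <= k ^ d) ->
  exists g', separated (P :|: Q) g'.
Proof.
move=> k0 sepP; have [m] := ubnP #|Q|; elim: m Q => // m IH Q le_m few.
have [->|[v vQ]] := set_0Vmem Q; first by exists g; rewrite setU0.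
have subQ : P :|: Q :\ v \subset P :|: Q by apply: setUS; apply: subD1set.
have few' w d : w \in Q -> 0 < d <= t ->
    #|crowd (P :|: Q :\ v) d w| * (2 ^ t * t.+1) <= k ^ d.
  move=> wQ dt; apply: leq_trans (few w wQ d dt); rewrite leq_mul2r.
  apply/orP; right; apply: subset_leq_card; apply/subsetP => u.
  by rewrite !inE => /andP [uPQ ->]; rewrite -in_setU (subsetP subQ) // !inE.
have [|w wQ' d dt|g' sep'] := IH (Q :\ v).
- by rewrite (cardsD1 v) vQ in le_m; lia.
- by apply: few' => //; case/setD1P: wQ'.
have [x x_ok] := greedy_step g' k0 (fun d => few' v d vQ).
exists (fun u => if u == v then x else g' u) => u w.
have mem z : z \in P :|: Q -> z != v -> z \in P :|: Q :\ v.
  by rewrite !inE => /orP [->|-> ->] //; rewrite orbT.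
move=> uPQ wPQ uw d dt uwd; case: eqVneq => [uv|uv]; case: eqVneq => [wv|wv].
- by rewrite uv wv eqxx in uw.
- by subst u; rewrite agreeC; apply: x_ok => //; apply: mem.
- by subst w; apply: x_ok; rewrite 1?reachC //; apply: mem.
- by apply: sep' => //; apply: mem.
Qed.

(** The colours are the pairs (position, letter): words have a common colour
    for each position where they agree. *)
Lemma separated_tcolorable (g : 'I_n -> {ffun 'I_t -> 'I_k}) :
  separated [set: 'I_n] g -> tcolorable t (t * k) E.
Proof.
move=> sep; have <- : #|{: 'I_t * 'I_k}| = t * k by rewrite card_prod !card_ord.
pose c u i : 'I_#|{: 'I_t * 'I_k}| := enum_rank (i, g u i).
have c_inj u : injective (c u) by move=> i j /enum_rank_inj [].
apply/existsP; exists [ffun u => [set c u i | i : 'I_t]].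
have c_t u : #|[set c u i | i : 'I_t]| = t by rewrite card_imset // card_ord.
apply/andP; split; first by apply/forallP => u; rewrite ffunE c_t.
apply/forallP => u; apply/forallP => v; apply/implyP => uv; rewrite !ffunE.
case duv : (dist E u v) => [d|//]; have uvd := dist_reach duv.
have d0 : 0 < d by case: d uvd {duv} => //=; rewrite (negPf uv).
have cap : [set c u i | i : 'I_t] :&: [set c v i | i : 'I_t]
    \subset c u @: agree (g u) (g v).
  apply/subsetP => _ /setIP [/imsetP [i _ ->] /imsetP [j _ /enum_rank_inj [<- gi]]].
  by apply: imset_f; rewrite inE gi.
apply: leq_ltn_trans (subset_leq_card cap) _; rewrite card_imset //.
case: (leqP d t) => [le_dt|]; first by apply: sep; rewrite ?inE // d0.
by apply: leq_ltn_trans; rewrite -[t in _ <= t]card_ord max_card.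
Qed.

End Words.

(** * Ball sizes under a bound on the heavy load *)

Section BallSize.
Variables (t h C n : nat) (E : {set {set 'I_n}}).
Hypothesis load : forall v, heavy_load E h t v <= C * h ^ (2 * t).

Lemma ball_subset d e v : d <= e -> ball E d v \subset ball E e v.
Proof. by move=> le_de; apply/subsetP => u; rewrite !inE; apply: reach_mono. Qed.

Lemma heavy_sum (A : {set 'I_n}) x v : h <= x -> A \subset ball E t v ->
  \sum_(w in A | x <= deg E w) deg E w <= C * h ^ (2 * t).
Proof.
move=> le_hx sub; apply: leq_trans (load v).
rewrite /heavy_load [leqRHS](bigID (fun w => (w \in A) && (x <= deg E w))) /=.
apply: leq_trans _ (leq_addr _ _).
apply: eq_leq; apply: eq_bigl; move=> w; apply/idP/andP => [/andP [wA xw]|[] //].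
by rewrite (subsetP sub) // (leq_trans le_hx) // wA xw.
Qed.

(** Vertices of degree below [x] have at most [x] neighbours each; the load bounds the degree sum of
    the others. It serves for [x = h] and for [x = h ^ t]. *)
Lemma card_ballS_le d x v : d <= t -> h <= x ->
  #|ball E d.+1 v| <= #|ball E d v| * x.+1 + C * h ^ (2 * t).
Proof.
move=> le_dt le_hx; apply: leq_trans (card_ballS _ _ _) _.
rewrite mulnS -addnA leq_add2l (bigID (fun w => x <= deg E w)) /= addnC.
apply: leq_add; last by apply: heavy_sum; last exact: ball_subset.
apply: leq_trans (_ : (\sum_(w in ball E d v) x) <= _); last by rewrite sum_nat_const.
rewrite [leqRHS](bigID (fun w => x <= deg E w)) /=.
apply: leq_trans _ (leq_addl _ _); apply: leq_sum => w /andP [_].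
by rewrite -ltnNge => /ltnW.
Qed.

(** Each step costs a factor [h.+1] and a summand [C * h ^ (2 * t)]; raising the factor to [h + 2]
    absorbs the summand. *)
Lemma card_ball_le d v : 0 < h -> d <= t ->
  #|ball E d v| <= C.+1 * h ^ (2 * t) * (h + 2) ^ d.
Proof.
move=> h0; have s0 : 0 < h ^ (2 * t) by rewrite expn_gt0 h0.
elim: d => [|d IH] lt_dt; first by rewrite ball0 cards1; nia.
apply: leq_trans (card_ballS_le v (ltnW lt_dt) (leqnn h)) _.
have := IH (ltnW lt_dt); have : 0 < (h + 2) ^ d by rewrite expn_gt0 addn2.
rewrite expnS; move: #|_| (h ^ _) ((h + 2) ^ d) s0 => a s y s0 y0 le_a.
apply: leq_trans (_ : C.+1 * s * y * h.+1 + C.+1 * s * y <= _); last by nia.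
apply: leq_add; first by rewrite leq_mul2r le_a orbT.
by rewrite -[leqLHS]muln1; apply: leq_mul => //; rewrite leq_mul2r leqnSn orbT.
Qed.

End BallSize.

(** The factor [t] counts the positions in a colour, [(C + 4) * 3 ^ t] comes from the crowd sizes,
    and [2 ^ t * t.+1] is the loss in [greedy_step]. *)
Definition tone_const (t C : nat) : nat :=
  t * ((C + 4) * 3 ^ t * (2 ^ t * t.+1)).

(** With [k] of order [h ^ t], a vertex may see only [O(h ^ (t * d))] coloured vertices within
    distance [d]. At [d = 1] a vertex of very large degree would violate this, so those in [big] are
    coloured first, when only members of [big] count. *)
Lemma heavy_load_tcolorable t h C n (E : {set {set 'I_n}}) :
  0 < t -> 0 < h -> (forall v, heavy_load E h t v <= C * h ^ (2 * t)) ->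
  tcolorable t (tone_const t C * h ^ t) E.
Proof.
move=> t0 h0 load; rewrite /tone_const -mulnA.
set k := _ * _ * _ * _.
have H0 : 0 < h ^ t by rewrite expn_gt0 h0.
have hH : h <= h ^ t by rewrite -{1}(expn1 h) leq_pexp2l.
have HH : h ^ (2 * t) = h ^ t * h ^ t by rewrite mul2n -addnn expnD.
have k0 : 0 < k by rewrite !muln_gt0 !expn_gt0 h0 !addn_gt0 orbT.
have few N d : 0 < d -> N <= (C + 4) * 3 ^ t * (h ^ t) ^ d ->
    N * (2 ^ t * t.+1) <= k ^ d.
  move=> d0 le_N; rewrite /k expnMn.
  apply: leq_trans (_ : (C + 4) * 3 ^ t * (2 ^ t * t.+1) * (h ^ t) ^ d <= _).
    rewrite mulnAC leq_mul2r; apply/orP; right; lia.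
  rewrite leq_mul2r -{1}[_ * (2 ^ t * _)]expn1 leq_pexp2l ?orbT //.
  by rewrite !muln_gt0 !expn_gt0 !addn_gt0 orbT.
pose big := [set v | h ^ t <= deg E v].
have [g sep_big] : exists g : 'I_n -> {ffun 'I_t -> 'I_k}, separated E (set0 :|: big) g.
  apply: (greedy (g := fun=> [ffun=> Ordinal k0])) => // [u v|v _ d /andP [d0 dt]].
    by rewrite inE.
  apply: few => //; apply: leq_trans (_ : C * h ^ t <= _); last first.
    apply: leq_mul; first by have := expn_gt0 3 t; nia.
    by rewrite -{1}[h ^ t]expn1 leq_pexp2l.
  (* Each member of [A] adds at least [h ^ t] to a load of at most [C * h ^ (2 * t)], so [A] has at
     most [C * h ^ t] members; this serves all [d] at once. *)
  pose A := ball E t v :&: big.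
  have : #|A| * h ^ t <= C * h ^ (2 * t).
    apply: leq_trans (heavy_sum load (A := A) hH (subsetIl _ _)).
    rewrite -sum_nat_const [leqRHS](eq_bigl (mem A)) => [|w]; last first.
      by rewrite !inE; case: (h ^ t <= _); rewrite ?andbF ?andbT.
    by apply: leq_sum => w; rewrite !inE => /andP [].
  rewrite HH mulnA leq_mul2r eqn0Ngt H0 /=; apply: leq_trans.
  apply: subset_leq_card; apply/subsetP => u.
  rewrite /crowd set0U 3!inE => /andP [ubig /andP [_ ud]].
  by apply/setIP; split; [exact: (subsetP (ball_subset E v dt))|rewrite inE].
have [|g' sep] := greedy (Q := ~: big) k0 sep_big; last first.
  by apply: (separated_tcolorable (g := g')); rewrite -[setT](setUCr big) -{1}[big]set0U.
move=> v; rewrite !inE -ltnNge => small d /andP [d0 dt]; apply: few => //.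
apply: leq_trans (_ : #|ball E d v :\ v| <= _).
  by apply: subset_leq_card; apply/subsetP => u; rewrite inE => /andP [].
have B0 : C + 4 <= (C + 4) * 3 ^ t by rewrite leq_pmulr // expn_gt0.
(* Radius 1 uses the degree of [v], radius 2 the splitting at [x = h ^ t]. From radius 3 on, the
   crude bound of order [h ^ (2 * t) * (h + 2) ^ t] is good enough. *)
case: d d0 dt => [//|[|[|d]]] _ dt.
- have -> : ball E 1 v :\ v = [set w | adj E v w].
    apply/setP => w; rewrite ball1 !inE; case: eqVneq => //= ->.
    by rewrite /adj eqxx.
  rewrite expn1; apply: leq_trans (ltnW small) _; nia.
- apply: leq_trans (subset_leq_card (subsetDl _ _)) _.
  apply: leq_trans (card_ballS_le load v (ltnW dt) hH) _.
  have : #|ball E 1 v| <= (h ^ t).+1.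
    rewrite ball1 cardsU1; apply: leq_add (leq_b1 _) (ltnW small).
  move: #|_| => a le_a; rewrite HH -mulnn.
  apply: leq_trans (_ : (C + 4) * (h ^ t * h ^ t) <= _); last by rewrite leq_mul2r B0 orbT.
  move: (h ^ t) H0 le_a => H; nia.
- apply: leq_trans (subset_leq_card (subsetDl _ _)) _.
  apply: leq_trans (card_ball_le load v h0 dt) _.
  apply: leq_trans (_ : C.+1 * h ^ (2 * t) * (3 * h) ^ t <= _).
    rewrite leq_mul2l; apply/orP; right.
    apply: leq_trans (_ : (h + 2) ^ t <= _); first by rewrite leq_pexp2l ?addn2.
    by rewrite leq_exp2r //; lia.
  rewrite expnMn HH -{1}[h ^ t]expn1.
  apply: leq_trans (_ : (C + 4) * 3 ^ t * (h ^ t) ^ 3 <= _).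
    rewrite !expnS expn0; nia.
  by rewrite leq_mul2l leq_pexp2l ?orbT.
Qed.

(** * Trees and their incident edges *)

Lemma sum_nat_bool (T : finType) (A : {set T}) (P : pred T) :
  \sum_(x in A) (P x : nat) = #|[set x in A | P x]|.
Proof.
rewrite -sum1dep_card big_mkcondr; apply: eq_bigr => x _; by case: (P x).
Qed.

Section Trees.
Variable n : nat.
Implicit Types (E : {set {set 'I_n}}) (x : {set 'I_n} * {set {set 'I_n}}).

(** Trees with [q] edges, as pairs (vertex set, edge set).  Growing them leaf by
    leaf costs the factor [q`!] in [card_trees], which is harmless because only
    [q] of order [s / h] occurs. *)
Fixpoint trees (q : nat) : {set {set 'I_n} * {set {set 'I_n}}} :=
  if q is q'.+1 then
    \bigcup_(x in trees q')
      [set (w |: x.1, [set u; w] |: x.2) | u in x.1, w in ~: x.1]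
  else [set ([set v], set0) | v : 'I_n].

Lemma treesP q x : x \in trees q ->
  [/\ #|x.1| = q.+1, #|x.2| = q, x.2 \subset pairs n
    & forall e, e \in x.2 -> e \subset x.1].
Proof.
elim: q x => [|q IH] x /=.
  by case/imsetP => v _ ->; split; rewrite ?cards1 ?cards0 ?sub0set // => e; rewrite inE.
case/bigcupP => y /IH [y1 y2 ypairs ysub] /imset2P [u w uy]; rewrite inE => wy -> /=.
have uw : u != w by apply: contraNneq wy => <-.
have wy2 : [set u; w] \notin y.2.
  by apply: contra wy => /ysub /subsetP; apply; rewrite !inE eqxx orbT.
split; rewrite ?cardsU1 ?wy ?wy2 ?y1 ?y2 //.
  by rewrite subUset ypairs sub1set inE cards2 uw.
move=> e /setU1P [->|/ysub sub_e]; last by apply: subset_trans sub_e (subsetU1 _ _).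
by apply/subsetP => z; rewrite !inE => /orP [] /eqP ->; rewrite ?eqxx // uy orbT.
Qed.

Lemma card_trees q : #|trees q| <= n ^ q.+1 * q`!.
Proof.
elim: q => [|q IH] /=.
  by rewrite muln1 expn1; apply: leq_trans (leq_imset_card _ _) _; rewrite card_ord.
apply: leq_trans (leq_card_bigcup _ _) _.
apply: leq_trans (_ : \sum_(x in trees q) q.+1 * n <= _).
  apply: leq_sum => x /treesP [x1 _ _ _]; rewrite curry_imset2X.
  apply: leq_trans (leq_imset_card _ _) _; rewrite cardsX x1 leq_mul2l.
  by rewrite -[n in _ <= n]card_ord max_card orbT.
rewrite sum_nat_const factS expnS.
by apply: leq_trans (leq_mul IH (leqnn _)) _; rewrite [leqRHS]mulnC; lia.
Qed.

(** Along a walk from [v] to [w], each step stays inside the tree or attaches one new leaf. *)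
Lemma tree_reach E q x v d w :
  x \in trees q -> x.2 \subset E -> v \in x.1 -> reach E d v w ->
  exists q' y, [/\ q' <= q + d, y \in trees q', y.2 \subset E,
    x.1 \subset y.1 & w \in y.1].
Proof.
move=> xq xE vx; elim: d w => [|d IH] w.
  by move/eqP <-; exists q, x; rewrite addn0.
case/orP => [/IH [q' [y [le_q' yq yE xy wy]]]|].
  by exists q', y; split => //; rewrite (leq_trans le_q') // leq_add2l leqnSn.
case/existsP => u /andP [/IH [q' [y [le_q' yq yE xy uy]]] /andP [uw uwE]].
have [wy|wy] := boolP (w \in y.1).
  by exists q', y; split => //; rewrite (leq_trans le_q') // leq_add2l leqnSn.
exists q'.+1, (w |: y.1, [set u; w] |: y.2); split => /=.
- by rewrite addnS ltnS.
- by apply/bigcupP; exists y => //; apply/imset2P; exists u w; rewrite ?inE.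
- by rewrite subUset sub1set uwE.
- by apply: subset_trans xy (subsetU1 _ _).
- by rewrite setU11.
Qed.

(** Start from the single vertex [v] and join the vertices of [W] one after another, each by at most
    [d] new edges. *)
Lemma tree_cover E v d (W : {set 'I_n}) : W \subset ball E d v ->
  exists q x, [/\ q <= #|W| * d, x \in trees q, x.2 \subset E & W \subset x.1].
Proof.
move=> subW.
suff [q [x [le_q xq xE _ sub]]] : exists q x,
    [/\ q <= #|W| * d, x \in trees q, x.2 \subset E, v \in x.1 & W \subset x.1].
  by exists q, x.
have [m] := ubnP #|W|; elim: m W subW => // m IH W subW lt_m.
have [->|[w wW]] := set_0Vmem W.
  exists 0, ([set v], set0); rewrite !sub0set set11; split=> //=.
  by apply/imsetP; exists v.
have cardW : #|W| = (#|W :\ w|).+1 by rewrite (cardsD1 w) wW.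
have [||q [x [le_q xq xE vx sub]]] := IH (W :\ w).
- by apply: subset_trans (subD1set _ _) subW.
- by rewrite cardW in lt_m.
have := subsetP subW w wW; rewrite inE => vw.
have [q' [y [le_q' yq yE xy wy]]] := tree_reach xq xE vx vw.
exists q', y; split => //.
  by rewrite cardW mulSn addnC (leq_trans le_q') // leq_add2r.
  exact: (subsetP xy).
by rewrite -(setD1K wW) subUset sub1set wy (subset_trans sub).
Qed.

Definition incident (S : {set 'I_n}) : {set {set 'I_n}} :=
  [set e in pairs n | e :&: S != set0].

Lemma card_incident S : #|incident S| <= #|S| * n.
Proof.
have sub : incident S \subset [set [set u; w] | u in S, w in [set: 'I_n]].
  apply/subsetP => e; rewrite !inE => /andP [/cards2P [a [b [ab ->]]]].
  case/set0Pn => z /setIP [/set2P [] -> zS]; apply/imset2P.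
    by exists a b.
  by exists b a => //; rewrite setUC.
apply: leq_trans (subset_leq_card sub) _; rewrite curry_imset2X.
by apply: leq_trans (leq_imset_card _ _) _; rewrite cardsX cardsT card_ord.
Qed.

Lemma sum_deg_le E (W : {set 'I_n}) : E \subset pairs n ->
  \sum_(w in W) deg E w <= 2 * #|E :&: incident W|.
Proof.
move=> Epairs.
(* Count incident pairs (vertex of [W], edge): an edge has only two ends. *)
apply: leq_trans (_ : \sum_(w in W) \sum_(e in E :&: incident W) (w \in e) <= _).
  apply: leq_sum => w wW; rewrite sum_nat_bool.
  pose f u := [set w; u].
  have f_inj : {in [set u | adj E w u] &, injective f}.
    move=> u u'; rewrite !inE => /andP [wu _] /andP [wu' _] /setP /(_ u).
    by rewrite !inE eqxx orbT eq_sym (negPf wu) /= => /esym /eqP.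
  rewrite /deg -(card_in_imset f_inj); apply: subset_leq_card.
  apply/subsetP => e /imsetP [u]; rewrite inE => /andP [wu wuE] ->.
  rewrite !inE wuE cards2 wu eqxx /= andbT.
  by apply/set0Pn; exists w; rewrite !inE eqxx.
rewrite exchange_big /= mulnC -sum_nat_const; apply: leq_sum => e.
rewrite !inE => /and3P [_ /eqP e2 _].
rewrite sum_nat_bool -[leqRHS]e2.
by apply: subset_leq_card; apply/subsetP => w; rewrite inE => /andP [].
Qed.

(** [X] has exactly [m] edges, none of them in the tree, so a given pair [x], [X] occurs with
    probability [p ^ (q + m)]. *)
Definition dense_tree E q m x (X : {set {set 'I_n}}) : bool :=
  [&& x \in trees q, X \subset incident x.1 :\: x.2, #|X| == m &
      x.2 :|: X \subset E].

(** Take all heavy vertices of the ball, or [r] of them if there are more: either way their degrees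
    sum to at least [2 * (m + r * d)]. This gives [m + r * d] edges incident to a covering tree, of
    which at most [r * d] belong to the tree. *)
Lemma dense_tree_ex E v d m r h :
  E \subset pairs n -> 2 * (m + r * d) <= r * h ->
  2 * (m + r * d) <= heavy_load E h d v ->
  exists q x X, q <= r * d /\ dense_tree E q m x X.
Proof.
move=> Epairs le_rh le_load.
pose H := [set w in ball E d v | h <= deg E w].
have [W [WH le_r le_W]] : exists W : {set 'I_n},
    [/\ W \subset H, #|W| <= r & 2 * (m + r * d) <= \sum_(w in W) deg E w].
  case: (leqP #|H| r) => [le_Hr|/ltnW /subset_card_ex [W WH Wr]].
    exists H; split => //; rewrite [leqRHS](eq_bigl (fun w => (w \in ball E d v) && (h <= deg E w))) //.
    by move=> w; rewrite !inE.
  exists W; split; rewrite ?Wr //; apply: leq_trans le_rh _.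
  rewrite -Wr -sum_nat_const; apply: leq_sum => w /(subsetP WH).
  by rewrite !inE => /andP [].
have Wball : W \subset ball E d v.
  by apply: subset_trans WH _; apply/subsetP => w; rewrite inE => /andP [].
have [q [x [le_q xq xE Wx]]] := tree_cover Wball.
have [_ x2 _ _] := treesP xq.
have [X] : exists2 X : {set {set 'I_n}}, X \subset (E :&: incident x.1) :\: x.2 & #|X| = m.
  apply: subset_card_ex.
  have sub : E :&: incident W \subset E :&: incident x.1.
    apply: setIS; apply/subsetP => e; rewrite !inE => /andP [-> /=].
    case/set0Pn => z /setIP [ze zW]; apply/set0Pn; exists z.
    by rewrite !inE ze (subsetP Wx).
  have := subset_leq_card sub; have := sum_deg_le W Epairs.
  rewrite cardsD; have := subset_leq_card (subsetIr (E :&: incident x.1) x.2).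
  rewrite x2; have := leq_mul le_r (leqnn d); lia.
rewrite subsetD subsetI => /andP [/andP [XE Xinc] Xdis] Xm.
exists q, x, X; split; first by apply: leq_trans le_q _; rewrite leq_mul2r le_r orbT.
by apply/and4P; split; rewrite ?subsetD ?Xm ?subUset ?xE // Xinc.
Qed.

End Trees.

(** * Numerical estimates *)

Lemma leq_expn_ffact n k : (n - k) ^ k <= n ^_ k.
Proof.
elim: k n => [|k IH] [|n] //; first by rewrite sub0n exp0n.
rewrite ffactnS expnS subSS /=; apply: leq_mul (IH n).
by apply: leq_trans (leq_subr _ _) _.
Qed.

Lemma leq_ffact_expn n k : n ^_ k <= n ^ k.
Proof.
elim: k n => [|k IH] // [|n] //.
rewrite ffactnS expnS leq_mul2l /=; apply: leq_trans (IH n) _.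
by case: k {IH} => // k; rewrite leq_exp2r.
Qed.

Lemma leq_bin_exp2 n k : 'C(n, k) <= 2 ^ n.
Proof.
rewrite -[n in 'C(n, _)]card_ord -card_draws -[n in leqRHS]card_ord -cardsT -card_powerset.
by apply: subset_leq_card; apply/subsetP => A _; rewrite powersetE subsetT.
Qed.

(** A weak Stirling bound: [m ^ m] is at most the falling factorial of [2 * m] of length [m], which
    is ['C(2 * m, m)] times the factorial of [m]. *)
Lemma leq_expn_fact m : m ^ m <= 4 ^ m * m`!.
Proof.
have := leq_expn_ffact (2 * m) m; rewrite {1}mul2n -addnn addnK => /leq_trans; apply.
rewrite -bin_ffact leq_mul2r; apply/orP; right.
by rewrite (_ : 4 = 2 ^ 2) // -expnM leq_bin_exp2.
Qed.

(** Cleared of denominators, this is the bound [1 / (Q.+1 * h)] on the [q]-th term of the first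
    moment. All powers of [n] cancel but one; the factorial in the denominator of the binomial
    coefficient pays for the rest. *)
Lemma dense_tree_term c0 n Q m h q : q <= Q -> 0 < c0 -> 0 < m ->
  n * c0 ^ Q.+1 * Q.+1 ^ Q.+1 * (4 * c0 * Q.+1) ^ m * (Q.+1 * h) <= m ^ m ->
  c0 ^ (q + m) * (n ^ q.+1 * q`! * 'C(q.+1 * n, m)) * (Q.+1 * h) <= n ^ (q + m).
Proof.
move=> le_qQ c0_gt0 m_gt0 le_mm.
have mm : 0 < m ^ m by rewrite expn_gt0 m_gt0.
rewrite -(leq_pmul2r mm).
apply: leq_trans (leq_mul (leqnn (n ^ (q + m))) le_mm).
apply: leq_trans (leq_mul (leqnn _) (leq_expn_fact m)) _.
have bin_le : 'C(q.+1 * n, m) * m`! <= Q.+1 ^ m * n ^ m.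
  rewrite bin_ffact -expnMn; apply: leq_trans (leq_ffact_expn _ _) _.
  by rewrite leq_exp2r // leq_mul2r ltnS le_qQ orbT.
have fact_le : q`! <= Q.+1 ^ Q.+1.
  rewrite -ffactnn; apply: leq_trans (leq_ffact_expn _ _) _.
  apply: leq_trans (_ : Q.+1 ^ q <= _); last by rewrite leq_pexp2l // leqW.
  by case: q le_qQ {bin_le} => // q le_qQ; rewrite leq_exp2r // leqW.
have c0_le : c0 ^ q <= c0 ^ Q.+1 by rewrite leq_pexp2l // leqW.
rewrite !expnMn !expnD (expnS n).
have := leq_mul (leq_mul c0_le fact_le) bin_le.
move: (c0 ^ q) (c0 ^ Q.+1) (q`!) (Q.+1 ^ Q.+1) 'C(_, _) (m`!) (Q.+1 ^ m) (n ^ m)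
  => a1 a2 b1 b2 d1 d2 e1 e2.
move: (c0 ^ m) (n ^ q) (4 ^ m) => f1 f2 f3.
move/(leq_mul (leqnn (f1 * (n * f2) * (Q.+1 * h) * f3))).
by congr (_ <= _); ring.
Qed.

(** [M' * s] bounds the sum of the exponents of [h] in the bounds on [n],
    [c0 ^ Q.+1], [Q.+1 ^ Q.+1] and [Q.+1 * h]; the remaining factor gains
    [h ^ (M' * s)] because [4 * c0 * Q.+1] is smaller than [M * s] by a factor
    of order [h]. *)
Lemma dense_tree_params t M' c0 h n :
  let K := 4 ^ t.+1 in
  let M := 2 * M' in
  let s := h ^ (2 * t) in
  let Q := 4 * M * h ^ (2 * t - 1) * t in
  0 < t -> M' = 2 * t * K + 4 * t + 2 -> 0 < c0 ->
  (32 * c0 * t) ^ 2 <= h -> 8 * t * M <= h ->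
  n <= h ^ (2 * t * K * s) ->
  n * c0 ^ Q.+1 * Q.+1 ^ Q.+1 * (4 * c0 * Q.+1) ^ (M * s) * (Q.+1 * h)
    <= (M * s) ^ (M * s).
Proof.
move=> K M s Q t_gt0 defM' c0_gt0 h_c0 h_M n_le.
have M_gt0 : 0 < M by rewrite /M; lia.
have h_gt0 : 0 < h by apply: leq_trans h_M; rewrite muln_gt0 M_gt0 muln_gt0 t_gt0.
have h'_gt0 : 0 < h ^ (2 * t - 1) by rewrite expn_gt0 h_gt0.
have def_s : s = h * h ^ (2 * t - 1).
  by rewrite /s -expnS; congr (h ^ _); lia.
have s_gt0 : 0 < s by rewrite expn_gt0 h_gt0.
have Ms_gt0 : 0 < M * s by rewrite muln_gt0 M_gt0.
have Q1_le : Q.+1 <= 8 * t * M * h ^ (2 * t - 1) by rewrite /Q; nia.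
have Q1_s : Q.+1 <= s by apply: leq_trans Q1_le _; rewrite def_s leq_mul2r h_M orbT.
have c0_h : c0 <= h.
  apply: leq_trans h_c0; rewrite -mulnn; apply: leq_trans (_ : 32 * c0 * t <= _); first by nia.
  by rewrite leq_pmulr // !muln_gt0 c0_gt0.
have hexp a b : a <= b -> h ^ a <= h ^ b by apply: leq_pexp2l.
have main : n * c0 ^ Q.+1 * Q.+1 ^ Q.+1 * (Q.+1 * h) <= h ^ (M' * s).
  have c0_le : c0 ^ Q.+1 <= h ^ s.
    by apply: leq_trans (hexp _ _ Q1_s); rewrite leq_exp2r.
  have QQ_le : Q.+1 ^ Q.+1 <= h ^ (2 * t * s).
    rewrite expnM -/s; apply: leq_trans (_ : s ^ Q.+1 <= _); first by rewrite leq_exp2r.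
    by rewrite leq_pexp2l.
  have Qh_le : Q.+1 * h <= h ^ ((2 * t).+1 * s).
    apply: leq_trans (_ : h ^ (2 * t).+1 <= _); last by apply: hexp; rewrite leq_pmulr.
    by rewrite expnS mulnC leq_mul2l Q1_s orbT.
  apply: leq_trans (leq_mul (leq_mul (leq_mul n_le c0_le) QQ_le) Qh_le) _.
  by rewrite -!expnD; apply: hexp; rewrite defM'; nia.
(* After multiplication by a further [h ^ (M' * s)], each of the [M * s] factors on the left is
   [4 * c0 * Q.+1 * h], at most [32 * c0 * t * (M * s)]; the square of [32 * c0 * t] is at most
   [h]. *)
have base : (4 * c0 * Q.+1) ^ (M * s) * h ^ (M' * s) <= (M * s) ^ (M * s).
  rewrite -(leq_pmul2r (_ : 0 < h ^ (M' * s))) ?expn_gt0 ?h_gt0 //.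
  rewrite -mulnA -expnD.
  have -> : M' * s + M' * s = M * s by rewrite /M; lia.
  rewrite -expnMn.
  apply: leq_trans (_ : (32 * c0 * t * (M * s)) ^ (M * s) <= _).
    rewrite leq_exp2r // def_s.
    apply: leq_trans (leq_mul (leq_mul (leqnn (4 * c0)) Q1_le) (leqnn h)) _.
    by apply: eq_leq; ring.
  rewrite expnMn mulnC leq_mul2l; apply/orP; right.
  have -> : M * s = 2 * (M' * s) by rewrite mulnA.
  by rewrite expnM leq_exp2r // muln_gt0 s_gt0 andbT; lia.
apply: leq_trans base; rewrite [leqRHS]mulnC.
apply: leq_trans (leq_mul main (leqnn _)).
by apply: eq_leq; ring.
Qed.

(** Take [h] maximal. As [h >= 2], passing to [h.+1] multiplies [s = h ^ (2 * t)] by at most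
    [4 ^ t <= s], so failure at [h.+1] bounds [n] by [(s ^ 2) ^ (2 * (4 ^ t * s))]. *)
Lemma scale_ex t h0 n : 0 < t -> 1 < h0 ->
  (h0 ^ (2 * t)) ^ (2 * h0 ^ (2 * t)) <= n ->
  exists h, [/\ h0 <= h, (h ^ (2 * t)) ^ (2 * h ^ (2 * t)) <= n &
    n <= h ^ (2 * t * 4 ^ t.+1 * h ^ (2 * t))].
Proof.
move=> t_gt0 h0_gt1 le_h0n.
pose P h := (h ^ (2 * t)) ^ (2 * h ^ (2 * t)) <= n.
have P_le h : P h -> h <= n.
  case: h => // h; apply: leq_trans; rewrite -expnM.
  by rewrite -{1}[h.+1]expn1 leq_pexp2l // !muln_gt0 t_gt0 expn_gt0.
have [h Ph max_h] := ex_maxnP (ex_intro P h0 le_h0n) P_le.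
have h0h := max_h _ le_h0n; exists h; split=> //.
have h_gt1 : 1 < h by apply: leq_trans h0h.
have : n < (h.+1 ^ (2 * t)) ^ (2 * h.+1 ^ (2 * t)).
  by rewrite ltnNge; apply/negP => /max_h; rewrite ltnn.
move/ltnW/leq_trans; apply; set s := h ^ (2 * t).
have s_gt0 : 0 < s by rewrite expn_gt0 (ltnW h_gt1).
have le_s : h.+1 ^ (2 * t) <= 4 ^ t * s.
  rewrite /s (_ : 4 = 2 ^ 2) // -expnM -expnMn leq_exp2r ?muln_gt0 //; lia.
have le_4s : 4 ^ t <= s.
  by rewrite /s expnM leq_exp2r // -[4]/(2 ^ 2) leq_exp2r.
apply: leq_trans (_ : (s ^ 2) ^ (2 * (4 ^ t * s)) <= _).
  apply: leq_trans (_ : (s ^ 2) ^ (2 * h.+1 ^ (2 * t)) <= _).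
    rewrite leq_exp2r ?muln_gt0 ?expn_gt0 //.
    by apply: leq_trans le_s _; rewrite -mulnn leq_mul2r le_4s orbT.
  by apply: leq_pexp2l; [rewrite expn_gt0 s_gt0|rewrite leq_mul2l].
rewrite -!expnM; apply: eq_leq; congr (h ^ _); rewrite [4 ^ t.+1]expnS; ring.
Qed.

(** This is [8 * M'] with the [M'] of [dense_tree_params]: a load of [4 * m], where
    [m = 2 * M' * s], will force a dense tree. *)
Definition load_const (t : nat) : nat := 8 * (2 * t * 4 ^ t.+1 + 4 * t + 2).

Definition good_graph (t h n : nat) (E : {set {set 'I_n}}) : bool :=
  (h ^ (2 * t) <= maxdeg E) &&
  [forall v, heavy_load E h t v <= load_const t * h ^ (2 * t)].

Lemma good_graph_tau t h n (E : {set {set 'I_n}}) : 0 < t -> 0 < h ->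
  good_graph t h E ->
  tau t E <= tone_const t (load_const t) * h ^ t.
Proof.
move=> t0 h0 /andP [_ /forallP load].
exact/tau_le/heavy_load_tcolorable.
Qed.

Local Open Scope ring_scope.

(** * The binomial random set *)

Section RandomSet.
Variables (F : realFieldType) (p : F) (T : finType).
Implicit Types (D E A : {set T}) (f g : {set T} -> F).

(** The law of the random subset of [D] that keeps each element independently with probability [p].
    A variable ground set [D] lets the edges be revealed in blocks. *)
Definition set_weight D E : F := p ^+ #|E| * (1 - p) ^+ (#|D| - #|E|).

Definition expect D f : F := \sum_(E : {set T} | E \subset D) set_weight D E * f E.

Lemma expectU A D f : [disjoint A & D] ->
  expect (A :|: D) f =
  \sum_(E : {set T} | E \subset A) set_weight A E *
    \sum_(E' : {set T} | E' \subset D) set_weight D E' * f (E :|: E').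
Proof.
move=> dis.
under [RHS]eq_bigr do rewrite big_distrr /=.
rewrite pair_big_dep /= /expect.
rewrite (reindex_onto (fun x : {set T} * {set T} => x.1 :|: x.2)
   (fun E => (E :&: A, E :&: D))) /=; last first.
  by move=> E sE; rewrite -setIUr; apply/setIidPl.
have dis0 (B C : {set T}) : B \subset A -> C \subset D -> B :&: C = set0.
  move=> sB sC; apply/eqP; rewrite setI_eq0.
  by apply: disjointWl sB _; apply: disjointWr sC _.
apply: eq_big => [[B C] /=|[B C] /= sBC].
  apply/andP/andP => [[_ /eqP [<- <-]]|[sB sC]]; first by rewrite !subsetIr.
  split; first exact: setUSS.
  rewrite !setIUl (setIidPl sB) (setIidPl sC) (dis0 _ _ sB (subxx _)).
  by rewrite [C :&: A]setIC (dis0 _ _ (subxx _) sC) setU0 set0U.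
have [sB sC] : B \subset A /\ C \subset D.
  by case/andP: sBC => _ /eqP [<- <-]; rewrite !subsetIr.
rewrite /set_weight !cardsU (dis0 _ _ (subxx _) (subxx _)) (dis0 _ _ sB sC).
rewrite cards0 !subn0 exprD.
have -> : (#|A| + #|D| - (#|B| + #|C|) = (#|A| - #|B|) + (#|D| - #|C|))%N.
  have := subset_leq_card sB; have := subset_leq_card sC; lia.
by rewrite exprD; ring.
Qed.

Lemma expect_card D k :
  expect D (fun E => (#|E| == k)%:R) =
  p ^+ k * (1 - p) ^+ (#|D| - k) *+ 'C(#|D|, k).
Proof.
rewrite /expect -cards_draws.
rewrite (bigID (fun E => #|E| == k)) /= addrC big1 ?add0r; last first.
  by move=> E /andP [_ /negPf ->]; rewrite mulr0.
rewrite -sumr_const; apply: eq_big => [E|E /andP [_ /eqP Ek]]; first by rewrite inE.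
by rewrite Ek eqxx mulr1 /set_weight Ek.
Qed.

Lemma expect1 D : expect D (fun=> 1) = 1.
Proof.
transitivity (((1 - p) + p) ^+ #|D|); last by rewrite subrK expr1n.
rewrite exprDn; under eq_bigr => k _ do rewrite mulrC -expect_card.
rewrite exchange_big /=; apply: eq_bigr => E sE; rewrite -big_distrr /=.
have lt : (#|E| < #|D|.+1)%N by rewrite ltnS subset_leq_card.
rewrite (bigD1 (Ordinal lt)) //= eqxx big1 ?addr0 // => k.
by rewrite -val_eqE /= eq_sym => /negPf ->.
Qed.

Lemma expect_subset D A : A \subset D -> expect D (fun E => (A \subset E)%:R) = p ^+ #|A|.
Proof.
move=> sA; have dis : [disjoint A & D :\: A].
  by rewrite disjoint_sym -setI_eq0 setIDAC setDIl setDv setI0.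
rewrite -(setID D A) (setIidPr sA) expectU // (bigD1 A) //= [X in _ + X]big1 ?addr0; last first.
  move=> E /andP [sE ne]; rewrite big1 ?mulr0 // => E' sE'.
  case: (boolP (A \subset _)) => [sAE|]; last by rewrite mulr0.
  case/negP: ne; rewrite eqEsubset sE; apply/subsetP => x xA.
  have /setUP [//|/(subsetP sE')] := subsetP sAE x xA.
  by rewrite inE xA.
under eq_bigr do rewrite subsetUl.
by rewrite -/(expect _ _) expect1 /set_weight subnn mulr1 mulr1.
Qed.

Hypothesis p01 : 0 <= p <= 1.

Lemma set_weight_ge0 D E : 0 <= set_weight D E.
Proof. by case/andP: p01 => p0 p1; rewrite mulr_ge0 ?exprn_ge0 ?subr_ge0. Qed.

Lemma ler_expect D f g : (forall E, E \subset D -> f E <= g E) -> expect D f <= expect D g.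
Proof.
by move=> fg; apply: ler_sum => E sE; rewrite ler_wpM2l ?set_weight_ge0 ?fg.
Qed.

Lemma expectD D f g : expect D (fun E => f E + g E) = expect D f + expect D g.
Proof. by rewrite -big_split; apply: eq_bigr => E _; rewrite mulrDr. Qed.

Lemma expect_sum D (I : finType) (P : pred I) (f : I -> {set T} -> F) :
  expect D (fun E => \sum_(i | P i) f i E) = \sum_(i | P i) expect D (f i).
Proof.
rewrite exchange_big; apply: eq_bigr => E _; rewrite big_distrr; exact: eq_bigr.
Qed.

(** Traces on the disjoint blocks [S i] are independent: [expectU] splits off the first block, and
    the rest is an event in [D :\: S i]. *)
Lemma expect_no_card (I : eqType) (S : I -> {set T}) (l : seq I) D b k :
  uniq l -> {in l &, forall i j, i != j -> [disjoint S i & S j]} ->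
  {in l, forall i, S i \subset D} -> {in l, forall i, #|S i| = b} ->
  expect D (fun E => (all (fun i => #|E :&: S i| != k) l)%:R) =
  (1 - p ^+ k * (1 - p) ^+ (b - k) *+ 'C(b, k)) ^+ size l.
Proof.
elim: l D => [|i l IH] D /=; first by rewrite expr0 expect1.
case/andP=> il ul dis sub card_b.
have mem_l j : j \in l -> j \in i :: l by rewrite inE => ->; rewrite orbT.
have ii := mem_head i l.
have disj j : j \in l -> [disjoint S i & S j].
  move=> jl; apply: dis; rewrite ?(mem_l _ jl) ?ii //.
  by apply/eqP => ij; rewrite ij jl in il.
have disD : [disjoint S i & D :\: S i].
  by rewrite disjoint_sym -setI_eq0 setIDAC setDIl setDv setI0.
rewrite -(setID D (S i)) (setIidPr (sub i ii)) expectU //.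
pose Y E' : F := (all (fun j => #|E' :&: S j| != k) l)%:R.
transitivity (\sum_(E : {set T} | E \subset S i) set_weight (S i) E *
    ((#|E| != k)%:R * expect (D :\: S i) Y)).
  apply: eq_bigr => E sE; congr (_ * _); rewrite big_distrr /=.
  apply: eq_bigr => E' sE'; rewrite mulrCA; congr (_ * _).
  have -> : (E :|: E') :&: S i = E.
    rewrite setIUl (setIidPl sE); apply/setUidPl.
    apply: subset_trans (setSI _ sE') _.
    by rewrite setIDAC setDIl setDv setI0 sub0set.
  rewrite -natrM mulnb; congr (_ && _)%:R; apply: eq_in_all => j jl.
  congr (#|pred_of_set _| != k); rewrite setIUl; apply/setUidPr.
  apply: subset_trans (setSI _ sE) _; have := disj j jl.
  by rewrite -setI_eq0 => /eqP ->; apply: sub0set.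
under eq_bigr do rewrite mulrA.
rewrite -big_distrl /= exprS; congr (_ * _).
  rewrite -(card_b i ii) -expect_card -[X in X - _](expect1 (S i)) /expect -sumrB.
  by apply: eq_bigr => E _; case: (_ == _); rewrite ?mulr0 ?mulr1 ?subr0 ?subrr.
apply: IH => // [j1 j2 /mem_l m1 /mem_l m2|j jl|j /mem_l]; first exact: dis.
  rewrite subsetD sub ?mem_l //= disjoint_sym; exact: disj.
exact: card_b.
Qed.

End RandomSet.

(** * First moment over trees *)

(** Union bound over trees and edge sets. At most [q.+1 * n] edges are incident to a tree, and
    [q + m] different edges must be present. *)
Lemma expect_dense_tree (F : realFieldType) (p : F) n (Q m : nat) :
  0 <= p <= 1 ->
  expect p (pairs n) (fun E => [exists q : 'I_Q.+1, exists x, exists X,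
     dense_tree E q m x X]%:R) <=
  \sum_(q < Q.+1) p ^+ (q + m) *+ (n ^ q.+1 * q`! * 'C(q.+1 * n, m)).
Proof.
move=> p01; have p0 : 0 <= p by case/andP: p01.
pose D (q : nat) (x : {set 'I_n} * {set {set 'I_n}}) :=
  [set X : {set {set 'I_n}} | X \subset incident x.1 :\: x.2 & #|X| == m].
apply: le_trans (_ : expect p (pairs n) (fun E => \sum_(q < Q.+1)
  \sum_(x in trees n q) \sum_(X in D q x) (x.2 :|: X \subset E)%:R) <= _).
  apply: ler_expect => // E _; case: existsP => [|_]; last first.
    by apply: sumr_ge0 => q _; apply: sumr_ge0 => x _; apply: sumr_ge0 => X _; apply: ler0n.
  case=> q /existsP [x /existsP [X /and4P [xq XI Xm XE]]].
  rewrite (bigD1 q) //= (bigD1 x) //= (bigD1 X) /= ?inE ?XI // XE.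
  rewrite -!addrA lerDl; apply: addr_ge0; last apply: addr_ge0.
  - by apply: sumr_ge0 => *; apply: ler0n.
  - by apply: sumr_ge0 => *; apply: sumr_ge0 => *; apply: ler0n.
  - by apply: sumr_ge0 => *; apply: sumr_ge0 => *; apply: sumr_ge0 => *; apply: ler0n.
rewrite expect_sum; apply: ler_sum => q _; rewrite expect_sum.
apply: le_trans (_ : \sum_(x in trees n q) p ^+ (q + m) *+ 'C(q.+1 * n, m) <= _); last first.
  rewrite sumr_const -mulrnA ler_wpMn2l ?exprn_ge0 // mulnC leq_mul2r.
  by rewrite card_trees orbT.
apply: ler_sum => x /treesP [x1 x2 xp _]; rewrite expect_sum.
apply: le_trans (_ : \sum_(X in D q x) p ^+ (q + m) <= _).
  apply: ler_sum => X; rewrite inE subsetD => /andP [/andP [XI dis] /eqP Xm].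
  rewrite expect_subset; last first.
    by rewrite subUset xp; apply: subset_trans XI _; apply/subsetP => e; rewrite inE => /andP [].
  rewrite cardsU x2 Xm; suff -> : x.2 :&: X = set0 by rewrite cards0 subn0.
  by apply/eqP; rewrite setI_eq0 disjoint_sym.
rewrite sumr_const ler_wpMn2l ?exprn_ge0 // cards_draws leq_bin2l //.
apply: leq_trans (subset_leq_card (subsetDl _ _)) (leq_trans (card_incident _) _).
by rewrite x1.
Qed.

Lemma expect_dense_tree_small (F : realFieldType) (c : F) (c0 n Q m h : nat) :
  0 < c <= c0%:R -> (0 < c0 <= n)%N -> (0 < m)%N -> (0 < h)%N ->
  (n * c0 ^ Q.+1 * Q.+1 ^ Q.+1 * (4 * c0 * Q.+1) ^ m * (Q.+1 * h) <= m ^ m)%N ->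
  expect (c / n%:R) (pairs n) (fun E => [exists q : 'I_Q.+1, exists x, exists X,
     dense_tree E q m x X]%:R) <= h%:R^-1.
Proof.
case/andP=> c_gt0 le_c /andP [c0_gt0 le_c0n] m_gt0 h_gt0 le_mm.
have n_gt0 : 0 < n%:R :> F by rewrite ltr0n (leq_trans c0_gt0).
have p_ge0 : 0 <= c / n%:R by rewrite divr_ge0 ?ltW.
have p01 : 0 <= c / n%:R <= 1.
  by rewrite p_ge0 ler_pdivrMr // mul1r (le_trans le_c) // ler_nat.
apply: le_trans (expect_dense_tree n Q m p01) _.
apply: le_trans (_ : \sum_(q < Q.+1) (Q.+1 * h)%:R^-1 <= _); last first.
  rewrite sumr_const card_ord -[_ *+ Q.+1]mulr_natr natrM invfM mulrAC.
  by rewrite mulVf ?mul1r // pnatr_eq0.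
apply: ler_sum => q _.
have qQ : (q <= Q)%N by rewrite -ltnS.
have := dense_tree_term qQ c0_gt0 m_gt0 le_mm.
move: (n ^ _ * _ * _)%N => N; rewrite -(ler_nat F) !natrM !natrX => le_N.
have Qh : 0 < Q.+1%:R * h%:R :> F by rewrite mulr_gt0 ?ltr0n.
rewrite -[leRHS]div1r ler_pdivlMr // -[_ *+ N]mulr_natr.
rewrite expr_div_n -mulrA mulrAC ler_pdivrMr ?exprn_gt0 // mul1r.
apply: le_trans le_N; rewrite -[leRHS]mulrA; apply: ler_wpM2r.
  by rewrite mulr_ge0 // ltW.
by rewrite lerXn2r ?nnegrE // ltW.
Qed.

(** * The maximum degree *)

Lemma bernoulli_ineq (F : realFieldType) (x : F) N :
  0 <= 1 + x -> 1 + x *+ N <= (1 + x) ^+ N.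
Proof.
move=> x1; elim: N => [|N IH]; first by rewrite mulr0n addr0 expr0.
rewrite exprS; apply: le_trans (ler_wpM2l x1 IH).
have : 0 <= x ^+ 2 *+ N by rewrite mulrn_wge0 ?sqr_ge0.
rewrite mulrSr -[x *+ N]mulr_natr -[x ^+ 2 *+ N]mulr_natr; nra.
Qed.

(** A substitute for the exponential bound on [(1 - x) ^+ N]: since [(1 - x) * (1 + x) <= 1],
    Bernoulli's inequality for [1 + x] suffices. *)
Lemma expr_sub1_le (F : realFieldType) (x : F) N :
  0 <= x <= 1 -> (1 - x) ^+ N * (x *+ N) <= 1.
Proof.
case/andP => x0 x1; have x0' : 0 <= 1 - x by rewrite subr_ge0.
apply: le_trans (_ : ((1 - x) * (1 + x)) ^+ N <= _); last first.
  by apply: exprn_ile1; nra.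
rewrite exprMn; apply: ler_wpM2l; first exact: exprn_ge0.
apply: le_trans (bernoulli_ineq N _); first by rewrite lerDr.
by rewrite addr_ge0.
Qed.

Section Stars.
Variables (n b : nat).
Hypothesis le_bn : (b <= n)%N.

(** For [v >= b] the stars are disjoint, so the numbers of edges in them are independent, unlike the
    degrees themselves. *)
Definition star (v : 'I_n) : {set {set 'I_n}} :=
  [set [set v; w] | w in [set w : 'I_n | (w < b)%N]].

Lemma card_star (v : 'I_n) : (b <= v)%N -> #|star v| = b.
Proof.
move=> bv; rewrite card_in_imset.
  by rewrite -sum1dep_card -(big_ord_widen n (fun=> 1%N)) // sum_nat_const card_ord muln1.
move=> w w'; rewrite !inE => wb w'b /setP /(_ w); rewrite !inE eqxx orbT.
case: (eqVneq w v) => [wv|_ /esym /eqP //].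
by rewrite wv ltnNge bv in wb.
Qed.

Lemma star_pairs (v : 'I_n) : (b <= v)%N -> star v \subset pairs n.
Proof.
move=> bv; apply/subsetP => _ /imsetP [w wb ->]; rewrite inE cards2.
by case: (eqVneq v w) => // vw; rewrite inE -vw ltnNge bv in wb.
Qed.

Lemma star_disjoint (v v' : 'I_n) : (b <= v)%N -> (b <= v')%N -> v != v' ->
  [disjoint star v & star v'].
Proof.
move=> bv bv' vv'; rewrite -setI_eq0; apply/eqP/setP => e; rewrite [RHS]inE.
apply/negP => /setIP [/imsetP [w wb ->] /imsetP [w' w'b]] /setP /(_ v).
rewrite !inE eqxx (negPf vv') /= => /esym /eqP vw'.
by rewrite inE -vw' ltnNge bv in w'b.
Qed.

Lemma card_star_deg E (v : 'I_n) : (b <= v)%N -> (#|E :&: star v| <= deg E v)%N.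
Proof.
move=> bv; apply: leq_trans (leq_imset_card (fun w => [set v; w]) _).
apply: subset_leq_card; apply/subsetP => e /setIP [eE /imsetP [w wb ew]].
apply/imsetP; exists w => //; rewrite inE /adj -ew eE andbT.
by apply/negP => /eqP vw; rewrite inE -vw ltnNge bv in wb.
Qed.

(** If the maximum degree is below [s], no star has exactly [s] edges; asking for exactly [s] keeps
    a single binomial term. *)
Lemma expect_maxdeg_lt (F : realFieldType) (p : F) s : 0 <= p <= 1 ->
  expect p (pairs n) (fun E => (maxdeg E < s)%N%:R) <=
  (1 - p ^+ s * (1 - p) ^+ (b - s) *+ 'C(b, s)) ^+ (n - b).
Proof.
move=> p01; pose l := [seq v <- enum 'I_n | b <= nat_of_ord v]%N.
have sz : size l = (n - b)%N.
  rewrite size_filter -sum1_count big_enum_cond /= sum1_card.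
  have <- : #|~: [set w : 'I_n | (w < b)%N]| = #|[pred v : 'I_n | b <= v]%N|.
    by apply: eq_card => v; rewrite !inE -leqNgt.
  rewrite cardsCs setCK card_ord; congr (_ - _)%N.
  by rewrite -sum1dep_card -(big_ord_widen n (fun=> 1%N)) // sum_nat_const card_ord muln1.
have l_b v : v \in l -> (b <= v)%N by rewrite mem_filter => /andP [].
rewrite -sz -(@expect_no_card _ _ _ _ star l (pairs n)) //; first last.
- by move=> v /l_b; apply: card_star.
- by move=> v /l_b; apply: star_pairs.
- by move=> v v' /l_b bv /l_b bv'; apply: star_disjoint.
- by rewrite filter_uniq ?enum_uniq.
apply: ler_expect => // E _; rewrite ler_nat; case: ltnP => // lt_s.
rewrite (_ : all _ _) //; apply/allP => v /l_b bv; apply: contraTneq lt_s => <-.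
by rewrite -leqNgt (leq_trans (card_star_deg E bv)) ?deg_le_maxdeg.
Qed.
End Stars.

(** A star has exactly [s] edges with probability [x] at least [(c / (4 * c0 * s)) ^ s / 2]. As
    [n >= s ^ (2 * s)], the expected number of such stars is at least [s / 4], and [expr_sub1_le]
    applies. *)
Lemma expect_maxdeg_small (F : realFieldType) (c : F) (c0 n s : nat) :
  0 < c <= c0%:R -> (4 * c0 <= s)%N -> (8 * c0)%:R <= s%:R * c ->
  (s ^ (2 * s) <= n)%N ->
  expect (c / n%:R) (pairs n) (fun E => (maxdeg E < s)%N%:R) <= 4 / s%:R.
Proof.
case/andP=> c_gt0 le_cc0 le_c0s le_c0sc le_sn.
have c0_gt0 : (0 < c0)%N by rewrite -(ltr0n F); apply: lt_le_trans le_cc0.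
have s4 : (4 <= s)%N by lia.
have s0 : (0 < s)%N by lia.
have s_gt0 : 0 < s%:R :> F by rewrite ltr0n.
have n_big : (s * s * s <= n)%N.
  apply: leq_trans le_sn; apply: leq_trans (_ : s ^ 3 <= _)%N.
    by rewrite !expnS expn0 muln1 mulnA.
  by rewrite leq_pexp2l; lia.
have n_gt0 : (0 < n)%N by nia.
have n_gt0F : 0 < n%:R :> F by rewrite ltr0n.
have c0n : (c0 <= n)%N by nia.
have cs : 0 < (4 * c0 * s)%:R :> F by rewrite ltr0n !muln_gt0 c0_gt0.
(* This [b] makes [p * b] at most [1 / 2], so that the factor [(1 - p) ^+ (b - s)] is at least one
   half. *)
set p := c / n%:R; pose b := (n %/ (2 * c0))%N.
have p_ge0 : 0 <= p by rewrite divr_ge0 ?ltW.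
have p01 : 0 <= p <= 1.
  by rewrite p_ge0 ler_pdivrMr // mul1r (le_trans le_cc0) // ler_nat.
have le_bn : (2 * b <= n)%N.
  apply: leq_trans (leq_trunc_div n (2 * c0)); rewrite mulnC leq_mul2l.
  by apply/orP; right; lia.
have b_le : (2 * c0 * b <= n)%N by rewrite mulnC leq_trunc_div.
have b_lt : (n < 2 * c0 * b.+1)%N by rewrite mulnC ltn_ceil //; lia.
have n_b : (n <= 2 * (n - b))%N by lia.
have n_bs : (n <= 4 * c0 * (b - s))%N.
  have : (4 * c0 * (s + 1) <= n)%N by nia.
  nia.
apply: le_trans (expect_maxdeg_lt (b := b) _ s p01) _; first by lia.
set x := _ *+ _.
have x_ge0 : 0 <= x by rewrite mulrn_wge0 ?mulr_ge0 ?exprn_ge0 // subr_ge0; case/andP: p01.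
have x_le1 : x <= 1.
  pose D := [set i : 'I_b | true]; have Db : #|D| = b by rewrite cardsT card_ord.
  rewrite /x -[in (b - s)%N]Db -[in 'C(b, s)]Db -expect_card -[leRHS](expect1 p D).
  by apply: ler_expect => // E _; rewrite lern1 leq_b1.
have half : 2^-1 <= (1 - p) ^+ (b - s).
  apply: le_trans (_ : (1 - p) ^+ b <= _); last first.
    apply: ler_wiXn2l; last by rewrite leq_subr.
      by rewrite subr_ge0; case/andP: p01.
    by rewrite gerBl.
  apply: le_trans (bernoulli_ineq b _); last by rewrite subr_ge0; case/andP: p01.
  suff : p *+ b <= 1 / 2 by rewrite mulNrn; lra.
  rewrite -mulr_natr /p mulrAC ler_pdivrMr //.
  have : (2 * c0 * b)%:R <= n%:R :> F by rewrite ler_nat.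
  rewrite !natrM => ?.
  have : c * b%:R <= c0%:R * b%:R by rewrite ler_wpM2r.
  lra.
have bin_ge : n%:R ^+ s <= (4 * c0 * s)%:R ^+ s * ('C(b, s))%:R :> F.
  rewrite -!natrX -natrM ler_nat.
  apply: leq_trans (_ : (4 * c0 * (b - s)) ^ s <= _)%N; first by rewrite leq_exp2r //; lia.
  rewrite expnMn [X in (_ <= X * _)%N]expnMn -[leqRHS]mulnA leq_mul2l; apply/orP; right.
  apply: leq_trans (leq_expn_ffact b s) _; rewrite -bin_ffact mulnC leq_mul2r.
  by apply/orP; right; rewrite -ffactnn leq_ffact_expn.
have x_ge : (c / (4 * c0 * s)%:R) ^+ s / 2 <= x.
  rewrite /x -[leRHS]mulr_natr mulrAC.
  have ns : 0 < n%:R ^+ s :> F by rewrite exprn_gt0.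
  apply: le_trans (_ : (c / (4 * c0 * s)%:R) ^+ s * (1 - p) ^+ (b - s) <= _).
    by apply: ler_wpM2l half; rewrite exprn_ge0 ?divr_ge0 ?ltW.
  apply: ler_wpM2r; first by apply: le_trans half; lra.
  rewrite /p !expr_div_n ler_pdivrMr ?exprn_gt0 // -!mulrA.
  apply: ler_peMr; first by rewrite exprn_ge0 ?ltW.
  by rewrite ler_pdivlMl // mulr1 mulrC.
have Nx : s%:R / 4 <= x *+ (n - b).
  apply: le_trans (_ : (c / (4 * c0 * s)%:R) ^+ s / 2 * (n%:R / 2) <= _); last first.
    rewrite -[leRHS]mulr_natr; apply: ler_pM => //.
    - by rewrite divr_ge0 ?exprn_ge0 ?divr_ge0 // ltW.
    - by rewrite divr_ge0.
    have : n%:R <= (2 * (n - b))%:R :> F by rewrite ler_nat.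
    by rewrite natrM ler_pdivrMr // mulrC.
  have sn : (s%:R * s%:R) ^+ s <= n%:R :> F.
    by rewrite -natrM -natrX ler_nat mulnn -expnM.
  have y_ge0 : 0 <= (c / (4 * c0 * s)%:R) ^+ s by rewrite exprn_ge0 ?divr_ge0 ?ltW.
  have : (c / (4 * c0 * s)%:R) ^+ s * (s%:R * s%:R) ^+ s <= (c / (4 * c0 * s)%:R) ^+ s * n%:R.
    by rewrite ler_wpM2l.
  rewrite -exprMn.
  have ge2 : 2 <= c / (4 * c0 * s)%:R * (s%:R * s%:R).
    have -> : c / (4 * c0 * s)%:R * (s%:R * s%:R) = s%:R * c / (4 * c0)%:R.
      rewrite !natrM; field.
      by rewrite !pnatr_eq0 -!lt0n c0_gt0 s0.
    rewrite ler_pdivlMr ?ltr0n ?muln_gt0 //.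
    by apply: le_trans le_c0sc; rewrite -natrM mulnA.
  have : s%:R <= (c / (4 * c0 * s)%:R * (s%:R * s%:R)) ^+ s.
    apply: le_trans (_ : 2 ^+ s <= _); last by rewrite lerXn2r ?nnegrE ?(le_trans _ ge2).
    by rewrite -natrX ler_nat ltnW // ltn_expl.
  lra.
have := expr_sub1_le (x := x) (n - b); rewrite x_ge0 x_le1 => /(_ isT).
have z_ge0 : 0 <= (1 - x) ^+ (n - b) by rewrite exprn_ge0 ?subr_ge0.
move/(le_trans (ler_wpM2l z_ge0 Nx)) => ?.
rewrite ler_pdivlMr //; lra.
Qed.

(** * The random graph *)

(** Every graph satisfies [P], has maximum degree below [s], or contains a dense tree; the last two
    events have probability at most [4 / h] and [1 / h]. *)
Lemma expect_good_graph (F : realFieldType) (c : F) (t c0 h n : nat)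
    (P : pred {set {set 'I_n}}) :
  (forall E, good_graph t h E -> P E) ->
  (0 < t)%N -> 0 < c <= c0%:R ->
  ((32 * c0 * t) ^ 2 <= h)%N -> (2 * t * load_const t <= h)%N ->
  (8 * c0)%:R <= h%:R * c ->
  ((h ^ (2 * t)) ^ (2 * h ^ (2 * t)) <= n)%N ->
  (n <= h ^ (2 * t * 4 ^ t.+1 * h ^ (2 * t)))%N ->
  1 - 5 / h%:R <= expect (c / n%:R) (pairs n) (fun E => (P E)%:R).
Proof.
move=> goodP t_gt0 c_c0; have /andP [c_gt0 le_c] := c_c0.
have c0_gt0 : (0 < c0)%N by rewrite -(ltr0n F); apply: lt_le_trans le_c.
move=> h_c0 h_load h_c sn ns.
set s := (h ^ (2 * t))%N in sn ns *.
pose M' := (2 * t * 4 ^ t.+1 + 4 * t + 2)%N.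
have M'_gt0 : (0 < M')%N by rewrite /M' addn2.
have h_M : (8 * t * (2 * M') <= h)%N.
  by move: h_load; rewrite /load_const -/M'; congr (_ <= _)%N; ring.
have h_t : (4 * t <= h)%N by apply: leq_trans h_M; nia.
have h_gt0 : (0 < h)%N by apply: leq_trans h_t; rewrite muln_gt0.
have le_hs : (h <= s)%N by rewrite -{1}[h]expn1 leq_pexp2l ?muln_gt0.
have c0_h : (4 * c0 <= h)%N.
  apply: leq_trans h_c0; rewrite -mulnn; apply: leq_trans (_ : 32 * c0 * t <= _)%N; first by nia.
  by rewrite leq_pmulr // !muln_gt0 c0_gt0.
have s_gt0 : (0 < s)%N by apply: leq_trans le_hs.
have c0_n : (c0 <= n)%N.
  apply: leq_trans sn; apply: leq_trans (_ : s <= _)%N; first by lia.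
  by rewrite -{1}[s]expn1 leq_pexp2l // muln_gt0.
have hsR : h%:R <= s%:R :> F by rewrite ler_nat.
have hR : 0 < h%:R :> F by rewrite ltr0n.
have sR : 0 < s%:R :> F by rewrite ltr0n.
have b1 : expect (c / n%:R) (pairs n) (fun E => (maxdeg E < s)%N%:R) <= 4 / h%:R.
  apply: le_trans (expect_maxdeg_small c_c0 _ _ sn) _.
  - exact: leq_trans le_hs.
  - by apply: le_trans h_c _; rewrite ler_wpM2r // ltW.
  - by rewrite ler_wpM2l // lef_pV2.
(* Chosen so that [r * h = 4 * m] and [r * t <= m]; then [2 * (m + r * t)] is at most [r * h], which
   equals [load_const t * s]. *)
pose r := (4 * (2 * M') * h ^ (2 * t - 1))%N.
pose m := (2 * M' * s)%N.
have b2 : expect (c / n%:R) (pairs n) (fun E => [exists q : 'I_(r * t).+1,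
    exists x, exists X, dense_tree E q m x X]%:R) <= h%:R^-1.
  apply: (expect_dense_tree_small c_c0); rewrite ?c0_gt0 //.
    by rewrite muln_gt0 s_gt0 muln_gt0 M'_gt0.
  exact: dense_tree_params.
have def_s : s = (h * h ^ (2 * t - 1))%N.
  by rewrite /s -expnS; congr (h ^ _)%N; move: t_gt0; clear; lia.
have rh : (r * h = 4 * m)%N by rewrite /r /m def_s; ring.
have rt : (r * t <= m)%N.
  by rewrite /r /m def_s; move: h_t; clear; nia.
set e := expect _ _ in b1 b2 *.
have : 1 <= e (fun E => (P E)%:R + ((maxdeg E < s)%N%:R +
   [exists q : 'I_(r * t).+1, exists x, exists X, dense_tree E q m x X]%:R)).
  rewrite -[leLHS](expect1 (c / n%:R) (pairs n)); apply: ler_expect.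
    rewrite divr_ge0 ?(ltW c_gt0) //= ler_pdivrMr ?ltr0n ?(leq_trans c0_gt0) // mul1r.
    by rewrite (le_trans le_c) // ler_nat.
  move=> E Epairs; case: (ltnP (maxdeg E) s) => lt_s /=.
    by rewrite addrCA lerDl addr_ge0.
  have [/goodP ->|] := boolP (good_graph t h E); first by rewrite lerDl addr_ge0.
  rewrite /good_graph -/s lt_s negb_forall => /existsP [v]; rewrite -ltnNge => lt_load.
  suff -> : [exists q : 'I_(r * t).+1, exists x, exists X, dense_tree E q m x X].
    by rewrite addrA lerDr addr_ge0.
  have le_m : (2 * (m + r * t) <= r * h)%N by rewrite rh; move: rt; clear; lia.
  have [|q [x [X [le_q dense]]]] := @dense_tree_ex _ E v t m r h Epairs le_m.
    apply: leq_trans (ltnW lt_load); apply: leq_trans le_m _; rewrite rh /m.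
    by rewrite /load_const -/M'; apply: eq_leq; ring.
  have lt_q : (q < (r * t).+1)%N by [].
  apply/existsP; exists (Ordinal lt_q); apply/existsP; exists x.
  by apply/existsP; exists X.
rewrite /e !expectD -/e; move: b1 b2.
by move: (e _) (e _) (e _) => x y z; move: (h%:R^-1) => k; lra.
Qed.

(** * Translation to the real numbers of the statement *)

Lemma gnp_probE n (p : R) (P : pred {set {set 'I_n}}) :
  gnp_prob n p P = expect p (pairs n) (fun E => (P E)%:R).
Proof.
rewrite /gnp_prob /expect big_mkcondr; apply: eq_bigr => E _.
have card_pairs : #|pairs n| = 'C(n, 2) by rewrite card_draws card_ord.
rewrite /set_weight card_pairs /gnp_weight !RpowE.
by case: (P E); rewrite ?mulr1 ?mulr0.
Qed.

Lemma RlebE (x y : R) : Rleb x y = (x <= y).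
Proof. by rewrite /Rleb; case: Rle_dec => /RleP //= /negPf ->. Qed.

Lemma sqrt_natX2 n : Num.sqrt ((n ^ 2)%N%:R) = n%:R :> R.
Proof. by rewrite natrX sqrtr_sqr ger0_norm. Qed.

Lemma sqrt_maxdeg_le_tau t n (E : {set {set 'I_n}}) : (2 <= t)%N ->
  Num.sqrt ((maxdeg E)%:R : R) <= (tau t E)%:R.
Proof.
by move=> t2; rewrite -[leRHS]sqrt_natX2 ler_wsqrtr // ler_nat maxdeg_le_sqr_tau.
Qed.

Lemma good_graph_sqrt_tau t h n (E : {set {set 'I_n}}) : (0 < t)%N -> (0 < h)%N ->
  good_graph t h E ->
  (tau t E)%:R <= (tone_const t (load_const t))%:R * Num.sqrt ((maxdeg E)%:R : R).
Proof.
move=> t0 h0 good; apply: le_trans (_ : (tone_const t (load_const t))%:R * (h ^ t)%:R <= _).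
  by rewrite -natrM ler_nat good_graph_tau.
rewrite ler_wpM2l // -[leLHS]sqrt_natX2 ler_wsqrtr // ler_nat -expnM mulnC.
by case/andP: good.
Qed.

Theorem theorem4 :
  forall t : nat, (3 <= t)%N ->
  exists c1 c2 : R, Rlt 0 c1 /\ Rlt 0 c2 /\
  forall c : R, Rlt 0 c ->
  forall eps : R, Rlt 0 eps ->
  exists N : nat, forall n : nat, (N <= n)%N ->
    Rle (Rminus 1 eps)
      (gnp_prob n (Rdiv c (INR n))
         (fun E => Rleb (Rmult c1 (sqrt (INR (maxdeg E)))) (INR (tau t E)) &&
                   Rleb (INR (tau t E)) (Rmult c2 (sqrt (INR (maxdeg E)))))).
Proof.
move=> t t3; have t_gt0 : (0 < t)%N by apply: leq_trans t3.
(* The lower bound holds with constant 1 in every graph; neither constant depends on [c]. *)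
exists 1, (tone_const t (load_const t))%:R; split; [exact/RltP/ltr01|split].
  by apply/RltP; rewrite ltr0n /tone_const !muln_gt0 !expn_gt0 addn_gt0 t_gt0 orbT.
move=> c /RltP c_gt0 eps /RltP eps_gt0.
pose c0 := Num.bound c; have c_c0 : 0 < c <= c0%:R.
  by rewrite c_gt0 ltW // archi_boundP // ltW.
pose b1 := Num.bound ((8 * c0)%:R / c); pose b2 := Num.bound (5 / eps).
have le_b1 : (8 * c0)%:R / c <= b1%:R by rewrite ltW // archi_boundP // divr_ge0 // ltW.
have le_b2 : 5 / eps <= b2%:R by rewrite ltW // archi_boundP // divr_ge0 // ltW.
(* One summand for each lower bound demanded of [h]: the first two serve the first moment over
   trees, [b1] the maximum degree, [b2] makes [5 / h] at most [eps], and [2] lets [scale_ex]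
   apply. *)
pose h0 := ((32 * c0 * t) ^ 2 + 2 * t * load_const t + b1 + b2 + 2)%N.
exists ((h0 ^ (2 * t)) ^ (2 * h0 ^ (2 * t)))%N => n le_n.
have h0_gt1 : (1 < h0)%N by rewrite /h0 addn2.
have [h [h0h sn ns]] := scale_ex t_gt0 h0_gt1 le_n.
have h_gt0 : (0 < h)%N by apply: leq_trans h0h; rewrite ltnW.
have le_h a b : h0 = (a + b)%N -> (a <= h)%N.
  by move=> def_h0; apply: leq_trans h0h; rewrite def_h0 leq_addr.
have hR : 0 < h%:R :> R by rewrite ltr0n.
apply/RleP; rewrite gnp_probE RdivE INRE.
apply: le_trans (expect_good_graph (h := h) _ t_gt0 c_c0 _ _ _ sn ns).
- rewrite RminusE lerB // ler_pdivrMr // mulrC -ler_pdivrMr //.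
  apply: le_trans le_b2 _; rewrite ler_nat.
  by apply: (le_h _ ((32 * c0 * t) ^ 2 + 2 * t * load_const t + b1 + 2)%N); rewrite /h0; ring.
- move=> E good; rewrite !RlebE !INRE !RmultE !RsqrtE mul1r sqrt_maxdeg_le_tau ?(leq_trans _ t3) //.
  by rewrite (good_graph_sqrt_tau t_gt0 h_gt0 good).
- by apply: (le_h _ (2 * t * load_const t + b1 + b2 + 2)%N); rewrite /h0; ring.
- by apply: (le_h _ ((32 * c0 * t) ^ 2 + b1 + b2 + 2)%N); rewrite /h0; ring.
- rewrite -ler_pdivrMr //; apply: le_trans le_b1 _; rewrite ler_nat.
  by apply: (le_h _ ((32 * c0 * t) ^ 2 + 2 * t * load_const t + b2 + 2)%N); rewrite /h0; ring.
Qed.
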